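(* Let $A\in\mathbb{C}^{n\times n}$ have index $k$, let $m$ be a positive integer, let $A_1=AA^{\mathrm{w}_m}A$, and let $X\in\mathbb{C}^{n\times n}$. Then the following conditions are equivalent: (a) $X=A^{\mathrm{w}_m,\dagger}$; (b) $\mathcal{R}(X)=\mathcal{R}(A^k)$ and $AX=A_1A^\dagger$; (c) $\mathcal{R}(X)=\mathcal{R}(A^k)$ and $A^*AX=A^*A_1A^\dagger$; (d) $\mathcal{R}(X)=\mathcal{R}(A^k)$ and $A^kX=A_1^kA^\dagger$; (e) $\mathcal{N}(X)=\mathcal{N}((A^k)^*A^{m+1}A^\dagger)$ and $XA=A^{\mathrm{w}_m}A$; (f) $\mathcal{N}(X)=\mathcal{N}((A^k)^*A^{m+1}A^\dagger)$ and $XAA^*=A^{\mathrm{w}_m}AA^*$.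
   Context: $r(\cdot)$, $\mathcal{R}(\cdot)$, $\mathcal{N}(\cdot)$, $(\cdot)^*$ denote rank, range, null space and conjugate transpose; $A^\dagger$ is the Moore-Penrose inverse and $A^D$ the Drazin inverse. The index of $A\in\mathbb{C}^{n\times n}$ is the smallest nonnegative integer $k$ with $r(A^{k+1})=r(A^k)$ (zeroth powers of matrices are $I_n$). For $A$ of index $k$, the core-EP inverse is $A^{\mathrm{cEP}}=A^DA^k(A^k)^\dagger$ and the $m$-weak group inverse is $A^{\mathrm{w}_m}=(A^{\mathrm{cEP}})^{m+1}A^m$. The $m$-weak group MP inverse $A^{\mathrm{w}_m,\dagger}$ is the unique $Y\in\mathbb{C}^{n\times n}$ satisfying $YAY=Y$, $AY=A_1A^\dagger$ and $YA=A^DA_1$, where $A_1=AA^{\mathrm{w}_m}A$. *)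

(* Defs.v *)
From mathcomp Require Import all_boot all_order all_algebra.
From mathcomp Require Import boolp classical_sets reals complex.

Set Implicit Arguments.
Unset Strict Implicit.
Unset Printing Implicit Defensive.

Import Order.TTheory GRing.Theory Num.Theory.

Local Open Scope ring_scope.
Local Open Scope classical_set_scope.
Local Open Scope sesquilinear_scope.

(* Matrices act on column vectors, whereas the row spaces of mxalgebra are
   made of row vectors; hence the explicit sets below. *)
Definition mxrange (C : numClosedFieldType) (p q : nat) (A : 'M[C]_(p, q)) :
  set 'cV[C]_p := range (fun v : 'cV[C]_q => A *m v).

Definition mxnull (C : numClosedFieldType) (p q : nat) (A : 'M[C]_(p, q)) :
  set 'cV[C]_q := [set v | A *m v = 0].

(* [xget 0 P] is an element of [P] if [P] is nonempty and 0 otherwise; it is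
   used below only for systems of equations that have exactly one solution. *)
Definition is_mpinv (C : numClosedFieldType) (p q : nat)
    (A : 'M[C]_(p, q)) (X : 'M[C]_(q, p)) : Prop :=
  [/\ A *m X *m A = A, X *m A *m X = X,
      (A *m X)^t* = A *m X & (X *m A)^t* = X *m A].

Definition mpinv (C : numClosedFieldType) (p q : nat) (A : 'M[C]_(p, q)) :
  'M[C]_(q, p) := xget 0 [set X | is_mpinv A X].

Fact mxindex_subproof (C : numClosedFieldType) (n : nat) (A : 'M[C]_n) :
  exists k, \rank (A ^+ k.+1) == \rank (A ^+ k).
Proof.
have rk_dec j : (\rank (A ^+ j.+1) <= \rank (A ^+ j))%N.
  by rewrite exprS; exact: mxrankM_maxr.
apply: contrapT => noeq.
have rk_bound j : (\rank (A ^+ j) + j <= n)%N.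
  elim: j => [|j IHj]; first by rewrite addn0 rank_leq_row.
  rewrite addnS -addSn; apply: leq_trans IHj; rewrite leq_add2r.
  rewrite ltn_neqAle rk_dec andbT; apply/negP => eq_j.
  by apply: noeq; exists j.
by have := leq_trans (leq_addl _ _) (rk_bound n.+1); rewrite ltnn.
Qed.

Definition mxindex (C : numClosedFieldType) (n : nat) (A : 'M[C]_n) : nat :=
  ex_minn (mxindex_subproof A).

Definition is_drazin (C : numClosedFieldType) (n : nat) (A X : 'M[C]_n) :
    Prop :=
  [/\ X *m A *m X = X, A *m X = X *m A &
      A ^+ (mxindex A).+1 *m X = A ^+ mxindex A].

Definition drazin (C : numClosedFieldType) (n : nat) (A : 'M[C]_n) :
  'M[C]_n := xget 0 [set X | is_drazin A X].

Definition core_ep (C : numClosedFieldType) (n : nat) (A : 'M[C]_n) :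
    'M[C]_n :=
  let k := mxindex A in drazin A *m A ^+ k *m mpinv (A ^+ k).

Definition weak_group_inv (C : numClosedFieldType) (n m : nat)
    (A : 'M[C]_n) : 'M[C]_n :=
  core_ep A ^+ m.+1 *m A ^+ m.

Definition weak_core_part (C : numClosedFieldType) (n m : nat)
    (A : 'M[C]_n) : 'M[C]_n :=
  A *m weak_group_inv m A *m A.

Definition is_weak_group_mp (C : numClosedFieldType) (n m : nat)
    (A Y : 'M[C]_n) : Prop :=
  let A1 := weak_core_part m A in
  [/\ Y *m A *m Y = Y, A *m Y = A1 *m mpinv A & Y *m A = drazin A *m A1].

Definition weak_group_mp (C : numClosedFieldType) (n m : nat)
    (A : 'M[C]_n) : 'M[C]_n :=
  xget 0 [set Y | is_weak_group_mp m A Y].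

(* Main.v *)
Require Import Defs.
From mathcomp Require Import all_boot all_order all_algebra.
From mathcomp Require Import boolp classical_sets reals complex.

(** Write G for the core-EP inverse of A, P = A^k (A^k)^+ for the orthogonal
    projector onto the range of A^k, W = G^(m+1) A^m for the m-weak group
    inverse and A^+ for the Moore-Penrose inverse.  Everything about G follows
    from A G = P, G P = G = P G and G A^(k+1) = A^k.  These give, for m > 0,
    that W A fixes A^k (hence every matrix whose range lies in that of A^k),
    that W A W = W and that A^D A_1 = W A.  So X0 = W A A^+ satisfies the three
    equations defining the m-weak group MP inverse; such a system has at most
    one solution, so X0 is that inverse ([weak_group_mpE]).

    Each other condition then turns out to be equivalent to X = X0.  X0 has the
    range of A^k, and A and A^k are both left-cancellable on matrices with that
    range: W undoes A there, and (A^D)^k undoes A^k.  Since A X0 = A_1 A^+ and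
    A^k X0 = A_1^k A^+ ([weak_core_part_expr_index]), (b) and (d) each determine
    X.  Dually, X0 = G^(m+1) A^(m+1) A^+ has the null space of
    (A^k)^* A^(m+1) A^+, because G^(m+1) and (A^k)^* are left multiples of one
    another.  That null space contains the range of I - A A^+, so in (e)
    X = X A A^+ is determined by X A.  Finally (c) and (f) reduce to (b) and (e)
    because A^* can be cancelled next to A.

    For the equations defining the Moore-Penrose and Drazin inverses to be
    usable, these inverses have to exist: [mpinvP] and [drazinP]. *)

Set Implicit Arguments.
Unset Strict Implicit.
Unset Printing Implicit Defensive.

Import Order.TTheory GRing.Theory Num.Theory.

Local Open Scope ring_scope.
Local Open Scope sesquilinear_scope.

(** * Conjugate transposes and the Moore-Penrose inverse *)

Lemma trmxC_mul (C : numClosedFieldType) (p q r : nat)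
    (A : 'M[C]_(p, q)) (B : 'M[C]_(q, r)) :
  (A *m B)^t* = B^t* *m A^t*.
Proof. by rewrite trmx_mul map_mxM. Qed.

Lemma mulmx_cV_inj (C : numClosedFieldType) (p q : nat) (X Y : 'M[C]_(p, q)) :
  (forall v : 'cV[C]_q, X *m v = Y *m v) -> X = Y.
Proof.
move=> eqXY; apply/matrixP=> i j.
by have /colP/(_ i) := eqXY (delta_mx j 0); rewrite -!colE !mxE.
Qed.

(** The j-th diagonal entry of B^* B is the squared norm of column j of B. *)
Lemma mulmx_trC_eq0 (C : numClosedFieldType) (p q : nat) (B : 'M[C]_(p, q)) :
  B^t* *m B = 0 -> B = 0.
Proof.
move=> BB0; apply/matrixP=> i j; rewrite mxE; apply/eqP.
have /matrixP/(_ j j) := BB0; rewrite !mxE => /eqP.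
rewrite psumr_eq0 => [/allP/(_ i (mem_index_enum _))|l _]; last first.
  by rewrite !mxE mulrC mul_conjC_ge0.
by rewrite !mxE mulrC /= mul_conjC_eq0.
Qed.

(** Applied to the difference Z = X - Y: (A Z)^* (A Z) = Z^* (A^* A Z) = 0. *)
Lemma mulmx_trC_cancell (C : numClosedFieldType) (p q r : nat)
    (A : 'M[C]_(p, q)) (X Y : 'M[C]_(q, r)) :
  A^t* *m A *m X = A^t* *m A *m Y -> A *m X = A *m Y.
Proof.
move=> /eqP; rewrite -subr_eq0 -mulmxBr => /eqP AAZ0.
apply/eqP; rewrite -subr_eq0 -mulmxBr; apply/eqP/mulmx_trC_eq0.
by rewrite trmxC_mul -mulmxA (mulmxA _ A) AAZ0 mulmx0.
Qed.

Lemma mulmx_trC_cancelr (C : numClosedFieldType) (p q r : nat)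
    (A : 'M[C]_(p, q)) (X Y : 'M[C]_(r, p)) :
  X *m A *m A^t* = Y *m A *m A^t* -> X *m A = Y *m A.
Proof.
move=> eqXY; rewrite -[X *m A]trmxCK -[Y *m A]trmxCK; congr (_ ^t* ).
rewrite !trmxC_mul; apply: mulmx_trC_cancell.
by have := congr1 (fun M => M^t* ) eqXY; rewrite !trmxC_mul !trmxCK !mulmxA.
Qed.

(** By cancellation, whatever A^* A annihilates on its right is annihilated by
    A, so both have the same row space. *)
Lemma submx_trC_mul (C : numClosedFieldType) (p q : nat) (A : 'M[C]_(p, q)) :
  exists Y, A = Y *m (A^t* *m A).
Proof.
apply/submxP; rewrite submxE; apply/eqP.
rewrite -[RHS](mulmx0 _ A); apply: mulmx_trC_cancell.
by rewrite mulmx_coker mulmx0.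
Qed.

(** With A = Y A^* A and A^* = Z A A^*, the matrices A Y^* and Z A are
    self-adjoint and satisfy A Y^* A = A = A Z A: Y^* and Z are one-sided
    Moore-Penrose inverses, and Z A Y^* combines them into a two-sided one. *)
Lemma mpinvP (C : numClosedFieldType) (p q : nat) (A : 'M[C]_(p, q)) :
  is_mpinv A (mpinv A).
Proof.
apply: (@xgetPex _ 0 [set X | is_mpinv A X]).
have [Y defA] := submx_trC_mul A.
have [Z] := submx_trC_mul (A^t*).
rewrite trmxCK => defAC.
have defA2 : A = A *m A^t* *m Z^t*.
  by have := congr1 (fun M => M^t* ) defAC; rewrite !trmxC_mul !trmxCK.
have AYC : (A *m Y^t* )^t* = A *m Y^t*.
  have -> : A *m Y^t* = Y *m (A^t* *m A) *m Y^t* by rewrite -defA.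
  by rewrite !trmxC_mul !trmxCK !mulmxA.
have ZAC : (Z *m A)^t* = Z *m A.
  have -> : Z *m A = Z *m (A *m A^t* ) *m Z^t* by rewrite -mulmxA -defA2.
  by rewrite !trmxC_mul !trmxCK !mulmxA.
have AYA : A *m Y^t* *m A = A.
  by rewrite -AYC trmxC_mul trmxCK -mulmxA -defA.
have AZA : A *m Z *m A = A.
  by rewrite -mulmxA -ZAC trmxC_mul mulmxA -defA2.
exists (Z *m A *m Y^t* ); split.
- by rewrite !mulmxA AZA AYA.
- by rewrite !mulmxA -2!(mulmxA Z) AYA -2!(mulmxA Z) AZA mulmxA.
- by rewrite !mulmxA AZA AYC.
- by rewrite -2!(mulmxA Z) AYA ZAC.
Qed.

(** * The Drazin inverse *)

Lemma expr_absorb_drazin (T : pzRingType) (a d : T) (k j : nat) :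
  a * d = d * a -> a ^+ k.+1 * d = a ^+ k -> d ^+ j * a ^+ j * a ^+ k = a ^+ k.
Proof.
move=> ad akd; elim: j => [|j IHj]; first by rewrite !mul1r.
rewrite exprSr -!mulrA (exprS a) -!mulrA -exprD addnC exprD.
rewrite (mulrA a) -exprS (mulrA d) (commrX k.+1 (esym ad)) akd.
by rewrite -exprD addnC exprD mulrA.
Qed.

(** Iterating the hypotheses gives u^(k+1) a^(2k+1) = a^k = a^(2k+1) v^(k+1), so
    u^(k+1) a^k = a^k v^(k+1); this element is the Drazin inverse, the left form
    controlling products on one side and the right form those on the other. *)
Lemma strongly_pi_regular_drazin (T : pzRingType) (a u v : T) (k : nat) :
  u * a ^+ k.+1 = a ^+ k -> a ^+ k.+1 * v = a ^+ k ->
  exists x, [/\ x * a * x = x, a * x = x * a & a ^+ k.+1 * x = a ^+ k].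
Proof.
move=> ua av.
have uaj j : u ^+ j * a ^+ (j + k) = a ^+ k.
  elim: j => [|j IHj]; first by rewrite mul1r.
  by rewrite exprSr addSnnS addnC exprD -mulrA (mulrA u) ua -exprD addnC.
have avj j : a ^+ (j + k) * v ^+ j = a ^+ k.
  elim: j => [|j IHj]; first by rewrite mulr1.
  by rewrite exprS addSnnS exprD -mulrA (mulrA (a ^+ k.+1)) av mulrA -exprD.
have xE : u ^+ k.+1 * a ^+ k = a ^+ k * v ^+ k.+1.
  by rewrite -{1}(avj k.+1) mulrA uaj.
have ax : a * (u ^+ k.+1 * a ^+ k) = u ^+ k.+1 * a ^+ k * a.
  rewrite {1}xE mulrA -exprS -mulrA -exprSr.
  transitivity (u ^+ k.+1 * a ^+ (k.+1 + k).+1 * v ^+ k.+1).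
    by rewrite [a ^+ (_ + _).+1]exprSr mulrA uaj -exprSr.
  by rewrite [a ^+ (_ + _).+1]exprS -!mulrA avj -exprS.
exists (u ^+ k.+1 * a ^+ k); split=> //.
  by rewrite {2}xE -!mulrA (mulrA a) -exprS (mulrA (a ^+ k)) -exprD
     addnC avj.
by rewrite xE mulrA -exprD avj.
Qed.

(** The powers A^k and A^(k+1) have the same rank at the index k, hence the same
    row space and the same column space, so each of them is both a left and a
    right multiple of the other. *)
Lemma drazinP (C : numClosedFieldType) (n : nat) (A : 'M[C]_n) :
  is_drazin A (drazin A).
Proof.
apply: (@xgetPex _ 0 [set X | is_drazin A X]); rewrite /is_drazin /=.
have rkA : \rank (A ^+ (mxindex A).+1) = \rank (A ^+ mxindex A).
  by rewrite /mxindex; case: ex_minnP => j /eqP.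
set k := mxindex A in rkA *.
have /submxP[U defU] : (A ^+ k <= A ^+ k.+1)%MS.
  have sub : (A ^+ k.+1 <= A ^+ k)%MS by rewrite exprS submxMl.
  by rewrite -(geq_leqif (mxrank_leqif_sup sub)) rkA.
have /submxP[V defV] : ((A ^+ k)^T <= (A ^+ k.+1)^T)%MS.
  have sub : ((A ^+ k.+1)^T <= (A ^+ k)^T)%MS.
    by rewrite exprSr trmx_mul submxMl.
  by rewrite -(geq_leqif (mxrank_leqif_sup sub)) !mxrank_tr rkA.
apply: (@strongly_pi_regular_drazin _ A U V^T) => //.
by apply: trmx_inj; rewrite [LHS]trmx_mul trmxK -defV.
Qed.

(** * The core-EP inverse and the m-weak group inverse *)

Section CoreEP.

Variables (C : numClosedFieldType) (n : nat) (A : 'M[C]_n).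
Local Notation k := (mxindex A).
Local Notation P := (A ^+ k * mpinv (A ^+ k)).
Local Notation G := (core_ep A).

Lemma drazin_comm : A * drazin A = drazin A * A.
Proof. by case: (drazinP A). Qed.

Lemma expr_drazin : A ^+ k.+1 * drazin A = A ^+ k.
Proof. by case: (drazinP A). Qed.

Lemma drazin_expr : drazin A * A ^+ k.+1 = A ^+ k.
Proof. by rewrite (commrX k.+1 (esym drazin_comm)) expr_drazin. Qed.

Lemma proj_expr : P * A ^+ k = A ^+ k.
Proof. by case: (mpinvP (A ^+ k)). Qed.

Lemma core_epE : G = drazin A * P.
Proof. by rewrite mulrA. Qed.

Lemma mul_core_ep : A * G = P.
Proof.
rewrite core_epE mulrA drazin_comm -!mulrA (mulrA A) -exprS.
by rewrite mulrA drazin_expr.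
Qed.

Lemma core_ep_proj : G * P = G.
Proof. by rewrite core_epE -!mulrA (mulrA (A ^+ k)) (mulrA P) proj_expr. Qed.

Lemma expr_core_ep_proj j : G ^+ j.+1 * P = G ^+ j.+1.
Proof. by rewrite exprSr -(mulrA _ G) core_ep_proj. Qed.

Lemma core_ep_factor : G = A ^+ k * (drazin A * mpinv (A ^+ k)).
Proof. by rewrite mulrA -(commrX k (esym drazin_comm)). Qed.

Lemma proj_core_ep : P * G = G.
Proof. by rewrite core_ep_factor (mulrA P) proj_expr. Qed.

Lemma core_ep_expr : G * A ^+ k.+1 = A ^+ k.
Proof.
rewrite core_epE exprSr mulrA -(mulrA (drazin A)) proj_expr.
by rewrite -mulrA -exprSr drazin_expr.
Qed.

Lemma drazin_core_ep : drazin A * G = G * G.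
Proof. by rewrite -{1}proj_core_ep mulrA -core_epE. Qed.

Lemma expr_core_ep_fix j : G ^+ j * A ^+ j * A ^+ k = A ^+ k.
Proof.
elim: j => [|j IHj]; first by rewrite !mul1r.
rewrite exprSr exprS -mulrA -(mulrA A) -exprD -exprS addnC -addSn exprD.
rewrite -(mulrA (G ^+ j)) (mulrA G).
by rewrite core_ep_expr -exprD addnC exprD mulrA.
Qed.

Lemma expr_mul_core_ep j : A ^+ j.+1 * G ^+ j.+1 = P.
Proof.
elim: j => [|j IHj]; first exact: mul_core_ep.
rewrite exprSr [G ^+ _]exprS -mulrA (mulrA A) mul_core_ep.
by rewrite [G ^+ _]exprS (mulrA P) proj_core_ep -exprS.
Qed.

Variables (m : nat) (m_gt0 : (0 < m)%N).
Local Notation W := (weak_group_inv m A).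
Local Notation A1 := (weak_core_part m A).

Lemma weak_group_invMr : W * A = G ^+ m.+1 * A ^+ m.+1.
Proof. by rewrite (exprSr A) mulrA. Qed.

Lemma weak_core_partE : A1 = G ^+ m * A ^+ m.+1.
Proof.
have -> : A1 = A * (W * A) by rewrite mulrA.
rewrite weak_group_invMr mulrA; congr (_ * _).
case: m m_gt0 => // j _; rewrite exprS mulrA mul_core_ep.
by rewrite [G ^+ _]exprS (mulrA P) proj_core_ep.
Qed.

Lemma drazin_weak_core_part : drazin A * A1 = W * A.
Proof.
rewrite weak_core_partE weak_group_invMr mulrA; congr (_ * _).
by case: m m_gt0 => // j _; rewrite !exprS mulrA drazin_core_ep mulrA.
Qed.

Lemma weak_group_inv_expr : W * A * A ^+ k = A ^+ k.
Proof. by rewrite weak_group_invMr expr_core_ep_fix. Qed.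

Lemma weak_group_inv_core_ep : W * A * G = G.
Proof. by rewrite core_ep_factor (mulrA (W * A)) weak_group_inv_expr. Qed.

Lemma weak_group_inv_idem : W * A * W = W.
Proof.
have WE : W = G * (G ^+ m * A ^+ m) by rewrite mulrA -exprS.
by rewrite {2}WE (mulrA (W * A)) weak_group_inv_core_ep -WE.
Qed.

Lemma weak_group_inv_weak_core_part : W * A * A1 = A1.
Proof.
have A1E : A1 = G * (G ^+ m.-1 * A ^+ m.+1).
  by rewrite weak_core_partE mulrA -exprS prednK.
by rewrite A1E (mulrA (W * A)) weak_group_inv_core_ep.
Qed.

(** A_1 A_1 = A (W A A_1) = A A_1: within powers of A_1 every factor but the
    last acts as A. *)
Lemma weak_core_part_expr j : A1 ^+ j.+1 = A ^+ j.+1 * (W * A).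
Proof.
elim: j => [|j IHj]; first by rewrite !expr1 mulrA.
rewrite exprSr IHj -mulrA weak_group_inv_weak_core_part.
by rewrite [A ^+ j.+2]exprSr -(mulrA (A ^+ _)); congr (_ * _); rewrite mulrA.
Qed.

(** For exponent 0 the formula of [weak_core_part_expr] would say W A = 1; this
    holds when k = 0, because W A then fixes A^0 = 1. *)
Lemma weak_core_part_expr_index : A1 ^+ k = A ^+ k * (W * A).
Proof.
have := weak_group_inv_expr.
case: k => [|j]; last by rewrite weak_core_part_expr.
by rewrite !expr0 mulr1 mul1r.
Qed.

End CoreEP.

(** Uniqueness: if U and V both solve the system, then
    V = V (A V) = V (A U) = (V A) U = (U A) U = U. *)
Lemma weak_group_mpE (C : numClosedFieldType) (n m : nat) (A : 'M[C]_n) :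
  (0 < m)%N -> weak_group_mp m A = weak_group_inv m A *m A *m mpinv A.
Proof.
move=> m_gt0; set W := weak_group_inv m A.
have [AMA _ _ _] := mpinvP A.
have WAM : is_weak_group_mp m A (W *m A *m mpinv A).
  have MA_r B : B *m A *m mpinv A *m A = B *m A.
    by rewrite -!mulmxA !(mulmxA A) AMA.
  split.
  - rewrite MA_r (mulmxA (W *m A) (W *m A)) (mulmxA (W *m A) W).
    by rewrite [W *m A *m W]weak_group_inv_idem.
  - by rewrite /weak_core_part !mulmxA.
  - by rewrite MA_r [RHS]drazin_weak_core_part.
have [VAV AV VA] : is_weak_group_mp m A (weak_group_mp m A).
  apply: (@xgetPex _ 0 [set Y | is_weak_group_mp m A Y]).
  by exists (W *m A *m mpinv A).
have [UAU AU UA] := WAM.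
by rewrite -VAV -mulmxA AV -AU mulmxA VA -UA UAU.
Qed.

(** * Ranges, null spaces and the characterizations *)

Lemma mulmx_fix_range (C : numClosedFieldType) (p q r : nat) (F : 'M[C]_p)
    (B : 'M[C]_(p, q)) (X : 'M[C]_(p, r)) :
  F *m B = B -> mxrange X = mxrange B -> F *m X = X.
Proof.
move=> FB XB; apply: mulmx_cV_inj => v; rewrite -mulmxA.
have : mxrange X (X *m v) by exists v.
by rewrite XB => -[w _ <-]; rewrite mulmxA FB.
Qed.

Lemma mxnull_eq_mulmx (C : numClosedFieldType) (p q r s : nat)
    (S : 'M[C]_(p, q)) (T : 'M[C]_(r, q)) (U : 'M[C]_(p, r)) (V : 'M[C]_(r, p))
    (M : 'M[C]_(q, s)) :
  S = U *m T -> T = V *m S -> mxnull (S *m M) = mxnull (T *m M).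
Proof.
move=> SU TV; apply/seteqP; split=> v /= Mv0; rewrite /mxnull /=.
  by rewrite TV -!mulmxA (mulmxA S) Mv0 mulmx0.
by rewrite SU -!mulmxA (mulmxA T) Mv0 mulmx0.
Qed.

Lemma mxrange_eq_mulmx (C : numClosedFieldType) (p q r : nat) (S : 'M[C]_(p, q))
    (T : 'M[C]_(p, r)) (U : 'M[C]_(r, q)) (V : 'M[C]_(q, r)) :
  S = T *m U -> T = S *m V -> mxrange S = mxrange T.
Proof.
move=> SU TV; apply/seteqP; split=> _ [v _ <-].
  by exists (U *m v) => //; rewrite mulmxA -SU.
by exists (V *m v) => //; rewrite mulmxA -TV.
Qed.

Theorem theorem4p1 (R : realType) (n : nat) (A : 'M[R[i]]_n) (k : nat)
    (hk : mxindex A = k) (m : nat) (hm : (0 < m)%N)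
    (A1 : 'M[R[i]]_n) (hA1 : A1 = A *m weak_group_inv m A *m A)
    (X : 'M[R[i]]_n) :
  [<-> X = weak_group_mp m A;
       mxrange X = mxrange (A ^+ k) /\ A *m X = A1 *m mpinv A;
       mxrange X = mxrange (A ^+ k) /\
         A^t* *m A *m X = A^t* *m A1 *m mpinv A;
       mxrange X = mxrange (A ^+ k) /\ A ^+ k *m X = A1 ^+ k *m mpinv A;
       mxnull X = mxnull ((A ^+ k)^t* *m A ^+ m.+1 *m mpinv A) /\
         X *m A = weak_group_inv m A *m A;
       mxnull X = mxnull ((A ^+ k)^t* *m A ^+ m.+1 *m mpinv A) /\
         X *m A *m A^t* = weak_group_inv m A *m A *m A^t*].
Proof.
set W := weak_group_inv m A in hA1 *; subst k.
set k := mxindex A.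
pose X0 := W *m A *m mpinv A.
have [AMA _ _ _] := mpinvP A.
have XE : weak_group_mp m A = X0 by exact: weak_group_mpE.
have A1E : A1 = weak_core_part m A by [].
have X0A : X0 *m A = W *m A by rewrite /X0 -!mulmxA (mulmxA A) AMA.
have WAk : W *m A *m A ^+ k = A ^+ k by exact: weak_group_inv_expr.
have A1k : A1 ^+ k *m mpinv A = A ^+ k *m X0.
  by rewrite A1E [weak_core_part m A ^+ k]weak_core_part_expr_index // -mulmxA.
have X0AA : X0 *m A *m mpinv A = X0 by rewrite X0A.
have rangeX0 : mxrange X0 = mxrange (A ^+ k).
  have X0k : A ^+ k = X0 *m (A *m A ^+ k) by rewrite mulmxA X0A WAk.
  have [B WE] : exists B, W = A ^+ k *m B.
    exists (drazin A * mpinv (A ^+ k) * (core_ep A ^+ m * A ^+ m)).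
    by rewrite [RHS]mulrA -core_ep_factor mulrA -exprS.
  by apply: (mxrange_eq_mulmx _ X0k); rewrite {1}/X0 WE -!mulmxA.
have nullX0 : mxnull X0 = mxnull ((A ^+ k)^t* *m A ^+ m.+1 *m mpinv A).
  have [PAk _ PC _] := mpinvP (A ^+ k).
  (* P^* = P exhibits G^(m+1) = G^(m+1) P as a left multiple of (A^k)^*; the
     converse is P = A^(m+1) G^(m+1) together with (A^k)^* P = (A^k)^*. *)
  have GP : core_ep A ^+ m.+1 =
      (core_ep A ^+ m.+1 *m (mpinv (A ^+ k))^t* ) *m (A ^+ k)^t*.
    by rewrite -mulmxA -trmxC_mul PC [RHS]expr_core_ep_proj.
  have PG : (A ^+ k)^t* = ((A ^+ k)^t* *m A ^+ m.+1) *m core_ep A ^+ m.+1.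
    rewrite -mulmxA [A ^+ m.+1 *m _]expr_mul_core_ep.
    by rewrite -[_ * _]PC -trmxC_mul PAk.
  rewrite -mulmxA -(mxnull_eq_mulmx _ GP PG) mulmxA.
  by congr (mxnull (_ *m _)); exact: weak_group_invMr.
tfae=> [->|[rX AX]|[rX AAX]|[rX AkX]|[nX XA]|[nX XAA]].
- by rewrite XE; split=> //; rewrite hA1 !mulmxA.
- by split=> //; rewrite -mulmxA AX !mulmxA.
- split=> //.
  have AX : A *m X = A *m X0.
    by apply: mulmx_trC_cancell; rewrite AAX hA1 !mulmxA.
  (* W A fixes X and X0, so W undoes A on both. *)
  have XX0 : X = X0.
    rewrite -(mulmx_fix_range WAk rX) -mulmxA AX mulmxA.
    exact: mulmx_fix_range WAk rangeX0.
  by rewrite XX0 A1k.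
- have DAk : drazin A ^+ k *m A ^+ k *m A ^+ k = A ^+ k.
    by apply: expr_absorb_drazin; [exact: drazin_comm | exact: expr_drazin].
  have XX0 : X = X0.
    rewrite -(mulmx_fix_range DAk rX) -mulmxA AkX A1k mulmxA.
    exact: mulmx_fix_range DAk rangeX0.
  by rewrite XX0 X0A nullX0.
- by split=> //; rewrite XA.
- rewrite XE.
  have XA : X *m A = W *m A by exact: mulmx_trC_cancelr.
  (* The range of I - A A^+ is contained in the null space of X0. *)
  rewrite /X0 -XA; apply: mulmx_cV_inj => v.
  apply/eqP; rewrite -subr_eq0 -!mulmxA -mulmxBr; apply/eqP.
  suff : mxnull X (v - A *m (mpinv A *m v)) by [].
  by rewrite nX -nullX0 /mxnull /= mulmxBr !mulmxA X0AA subrr.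
Qed.
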